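(* Let $S = \{s_1, s_2, \dots\} \subseteq \mathbb{Z}^+$ be an infinite set with elements listed in increasing order $s_1 < s_2 < \cdots$, such that $\liminf_{i \to \infty} (s_{i+1} - s_i) = \infty$. Then $\mathrm{ord}(S) \le 2$.
   Context: $\mathbb{Z}^+$ denotes the set of positive integers. A walk over a set $S \subseteq \mathbb{Z}^+$ is a finite or infinite sequence of integers $a_1, a_2, \dots$ such that $a_{i+1} - a_i \in S$ for all $i$ (for which $a_{i+1}$ is defined). For a positive integer $m$, the set $S$ is $m$-walkable if every coloring of $\mathbb{Z}$ with $m$ colors admits an infinitely long monochromatic walk over $S$. The order of $S$ is $\mathrm{ord}(S) := \sup\{m : S \text{ is } m\text{-walkable}\}$. *)

(* Defs.v *)
From mathcomp Require Import all_boot all_order all_algebra.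
From mathcomp Require Import all_classical all_reals all_analysis.

Set Implicit Arguments.
Unset Strict Implicit.
Unset Printing Implicit Defensive.

Import Order.TTheory GRing.Theory Num.Theory.

Local Open Scope classical_set_scope.
Local Open Scope ring_scope.

Definition infinite_walk (S : set int) (a : nat -> int) : Prop :=
  forall i, S (a i.+1 - a i).

Definition monochromatic (m : nat) (c : int -> 'I_m) (a : nat -> int) : Prop :=
  exists k : 'I_m, forall i, c (a i) = k.

Definition walkable (m : nat) (S : set int) : Prop :=
  forall c : int -> 'I_m,
    exists a : nat -> int, infinite_walk S a /\ monochromatic c a.

(* The order may be infinite, so the supremum is taken in the extended reals. *)
Definition ord (R : realType) (S : set int) : \bar R :=
  ereal_sup [set (m%:R)%:E | m in [set m : nat | (0 < m)%N /\ walkable m S]].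

(* Main.v *)
Require Import Defs.
From mathcomp Require Import all_boot all_order all_algebra.
From mathcomp Require Import all_classical all_reals all_analysis.
From mathcomp Require Import zify.

(** The claim is that [S] is not 3-walkable: a colouring with three colours
    defeats every walk, and it also serves when more colours are available.

    Cut the naturals into consecutive blocks I_l = [N_l, N_(l+1)) whose lengths
    grow so fast that two elements of [S] exceeding |I_l| are at least N_l
    apart; this is possible because the gaps of [S] tend to infinity.  On I_l
    the colour l mod 3 is forbidden.  A walk that keeps the colour j can
    therefore never visit a block I_k with k = j mod 3, and has to jump over it,
    from some x < N_k to some y in a later block I_l.  Then x < N_(l-1), and the
    step y - x is longer than I_(l-1), so the choice of the lengths leaves
    at most one such x for each y ([unique_long_step]).  Hence y has to avoid
    only two colours, l mod 3 and the colour of x, and the third one can be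
    chosen greedily from left to right ([greedy_coloring]).  In this colouring
    no jump over a block forbidden to its colour is monochromatic, so no
    monochromatic walk is infinite ([no_monochromatic_walk_nat]).

    On the integers the colour of an integer is that of its absolute value:
    steps are positive, so every walk is eventually nonnegative. *)

Set Implicit Arguments.
Unset Strict Implicit.
Unset Printing Implicit Defensive.

Import Order.TTheory GRing.Theory Num.Theory.

Local Open Scope classical_set_scope.
Local Open Scope ring_scope.

Lemma exists_third_color (T : finType) (a b : T) :
  (2 < #|T|)%N -> exists e : T, e != a /\ e != b.
Proof.
move=> T3.
have /card_gt0P[e] : (0 < #|~: [set a; b]%SET|)%N.
  rewrite cardsCs finset.setCK subn_gt0 cards2.
  by rewrite (leq_ltn_trans _ T3)//; case: eqP.
by rewrite !inE negb_or => /andP[? ?]; exists e.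
Qed.

(** Each vertex excludes one colour outright and one more through a single
    earlier neighbour [p y], so three colours suffice; [p y >= y] encodes the
    absence of such a neighbour. *)
Lemma greedy_coloring (T : finType) (f : nat -> T) (p : nat -> nat) :
  (2 < #|T|)%N ->
  exists c : nat -> T,
    forall y, c y != f y /\ ((p y < y)%N -> c y != c (p y)).
Proof.
move=> T3.
have [g gP] := choice (fun ab : T * T => exists_third_color ab.1 ab.2 T3).
(* The recursion along p is well founded; n is a bound on its depth. *)
pose fix col n y {struct n} := if n is n'.+1 then
  g (f y, if (p y < y)%N then col n' (p y) else f y) else f y.
have colE n y : (y < n)%N -> col n y = col y.+1 y.
  elim: n {-2}n (leqnn n) y => [|m IH] [|n] //= nm y yn.
  case: ifP => // py; rewrite (IH n) ?(IH y) //; lia.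
exists (fun y => col y.+1 y) => y; split; first exact: (gP (f y, _)).1.
move=> py; rewrite [col y.+1 y]/= py (colE y (p y) py).
exact: (gP (f y, _)).2.
Qed.

Lemma block_index (N : nat -> nat) :
  N 0%N = 0%N -> (forall k, (N k < N k.+1)%N) ->
  exists b : nat -> nat, forall y, (N (b y) <= y < N (b y).+1)%N.
Proof.
move=> N0 Nlt; suff /choice[b bP] : forall y, exists l, (N l <= y < N l.+1)%N.
  by exists b.
elim=> [|y [l /andP[ly yl]]]; first by exists 0%N; have := Nlt 0%N; rewrite N0.
case: (ltnP y.+1 (N l.+1)) => h; first by exists l; rewrite h (leq_trans ly).
by exists l.+1; rewrite h (leq_ltn_trans yl (Nlt _)).
Qed.

Definition sparse_beyond (P : set nat) (n D : nat) : Prop :=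
  forall u v, P u -> P v -> (D <= u)%N -> (u < v)%N -> (u + n <= v)%N.

(** Two such steps would be elements of [P] beyond [D] at distance |x - x'| < n.
    This is what makes one earlier vertex the only obstacle to the colour of
    [y]. *)
Lemma unique_long_step (P : set nat) (n D x x' y : nat) :
  sparse_beyond P n D -> (n + D <= y)%N -> (x < n)%N -> (x' < n)%N ->
  P (y - x)%N -> P (y - x')%N -> x = x'.
Proof.
move=> PnD nDy.
wlog lt_xx' : x x' / (x < x')%N.
  move=> wl xn x'n Px Px'; case: (ltngtP x x') => // xx'; first exact: wl.
  by apply/esym; exact: wl.
move=> xn x'n Px Px'; have := PnD _ _ Px' Px; lia.
Qed.

Lemma no_monochromatic_walk_nat (P : set nat) :
  (forall n, exists D, sparse_beyond P n D) ->
  exists c : nat -> 'I_3, forall b : nat -> nat,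
    (forall i, (b i < b i.+1)%N /\ P (b i.+1 - b i)%N) ->
    ~ exists k, forall i, c (b i) = k.
Proof.
move=> /choice[D DP].
pose N := fix N k := if k is k'.+1 then (N k' + D (N k')).+1 else 0%N.
have Nlt k : (N k < N k.+1)%N by rewrite /= ltnS leq_addr.
have [blk blkP] := block_index (erefl (N 0%N)) Nlt.
have Nle : {homo N : m n / (m <= n)%N}.
  exact: (homo_leq (@leqnn) leq_trans (fun k => ltnW (Nlt k))).
have N_ge k : (k <= N k)%N.
  by elim: k => // k IH; exact: leq_ltn_trans IH (Nlt k).
(* When no jump into y passes over a whole block, the default value y makes
   the second constraint of the greedy colouring vacuous. *)
pose p y := xget y [set x | (x < N (blk y).-1)%N /\ P (y - x)%N].
have [c cP] := @greedy_coloring 'I_3 (fun y => inord (blk y %% 3)) p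
  (eq_leq (esym (card_ord 3))).
have c_jump x y k : (x < N k)%N -> (k < blk y)%N -> P (y - x)%N -> c y != c x.
  move=> xk kl Pyx.
  have xl : (x < N (blk y).-1)%N by apply: leq_trans xk (Nle _ _ _); lia.
  have /andP[ly _] := blkP y.
  have Nl : (N (blk y) = (N (blk y).-1 + D (N (blk y).-1)).+1)%N.
    by case: (blk y) kl.
  have px : p y = x.
    rewrite /p; case: xgetP => [x' _ [x'l Pyx']|/(_ x)]; last by case.
    by apply: (unique_long_step (DP (N (blk y).-1))) Pyx' Pyx => //; lia.
  by rewrite -px; apply: (cP y).2; rewrite px; lia.
exists c => b bP [j cj].
(* A block forbidden to the colour j and lying beyond the start of the walk. *)
pose k := (j + 3 * (b 0).+1)%N.
have b_ge i : (i <= b i)%N.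
  by elim: i => // i IH; exact: leq_ltn_trans IH (bP i).1.
have ex_i : exists i, (N k <= b i)%N by exists (N k).
have [[|i] ki i_min] := ex_minnP ex_i.
  by have := N_ge k; rewrite /k in ki *; lia.
have xk : (b i < N k)%N.
  by rewrite ltnNge; apply/negP => /i_min; rewrite ltnn.
have /andP[_ yl] := blkP (b i.+1).
have kl : (k <= blk (b i.+1))%N.
  rewrite leqNgt; apply/negP => /Nle; lia.
have blk_neq : blk (b i.+1) != k.
  apply/eqP => bk; have [/eqP + _] := cP (b i.+1); apply.
  rewrite cj bk /k; apply/val_inj; rewrite /= inordK ?ltn_pmod//.
  by rewrite addnC mulnC modnMDl modn_small.
have := c_jump _ _ k xk _ (bP i).2; rewrite !cj eqxx => h.
by have : false by apply: h; rewrite ltn_neqAle eq_sym blk_neq.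
Qed.

Lemma limn_einf_pinfty (R : realType) (u : nat -> \bar R) (M : R) :
  limn_einf u = +oo%E -> exists i0, forall i, (i0 <= i)%N -> (M%:E <= u i)%E.
Proof.
rewrite limn_einf_lim => uoo.
have /ereal_sup_gt[_ [i0 _ <-] Mi0] : (M%:E < ereal_sup (range (einfs u)))%E.
  by rewrite -(cvg_lim _ (cvg_einfs_sup (u := u)))// uoo ltry.
exists i0 => i i0i; apply: le_trans (ltW Mi0) _.
by apply: ereal_inf_lbound; exists i.
Qed.

Lemma sparse_of_gaps (R : realType) (S : set int) (s : nat -> int) :
  range s = S -> increasing_seq s ->
  limn_einf (fun i : nat => ((s i.+1 - s i)%:~R : R)%:E) = +oo%E ->
  forall n, exists D, sparse_beyond [set d : nat | S d%:Z] n D.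
Proof.
move=> sS s_incr s_gaps n.
have [i0 i0P] := limn_einf_pinfty (n%:Z%:~R) s_gaps.
exists `|s i0|%N => u v; rewrite -sS => -[i _ iu] [j _ jv] Du uv.
have i0i : (i0 <= i)%N by rewrite -s_incr iu; lia.
have ij : (i < j)%N by rewrite ltnNge -s_incr iu jv; lia.
have /= := i0P i i0i; rewrite lee_fin ler_int.
by have := ij; rewrite -s_incr; lia.
Qed.

Lemma walk_ge (S : set int) (a : nat -> int) :
  S `<=` [set n : int | 0 < n] -> infinite_walk S a ->
  forall i, a 0%N + i%:Z <= a i.
Proof.
by move=> S_pos aS; elim=> [|i IH]; [lia|have /= := S_pos _ (aS i); lia].
Qed.

Lemma not_walkable3 (S : set int) :
  S `<=` [set n : int | 0 < n] ->
  (forall n, exists D, sparse_beyond [set d : nat | S d%:Z] n D) ->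
  ~ walkable 3 S.
Proof.
move=> S_pos /no_monochromatic_walk_nat[c cP] /(_ (fun z => c `|z|%N)).
move=> [a [aS [k ck]]].
(* The steps are at least 1, so the walk is nonnegative from |a 0| on. *)
pose i0 := `|a 0%N|%N.
have a_ge0 i : 0 <= a (i0 + i)%N by have := walk_ge S_pos aS (i0 + i); lia.
apply: (cP (fun i => `|a (i0 + i)%N|%N)); last by exists k => i; exact: ck.
move=> i; have := aS (i0 + i)%N; have /= := S_pos _ (aS (i0 + i)%N).
rewrite -addnS => a_lt aSi; have := a_ge0 i; have := a_ge0 i.+1 => ? ?.
split; first lia.
by rewrite (_ : _%:Z = a (i0 + i.+1)%N - a (i0 + i)%N)//; lia.
Qed.

Lemma walkable_le (S : set int) (m n : nat) :
  (m <= n)%N -> walkable n S -> walkable m S.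
Proof.
move=> mn nS c; have [a [aS [k ck]]] := nS (fun z => widen_ord mn (c z)).
exists a; split=> //; exists (c (a 0%N)) => i.
by apply/val_inj; have /(congr1 val) := etrans (ck i) (esym (ck 0%N)).
Qed.

Theorem corollary3p3 (R : realType) (S : set int) (s : nat -> int)
    (S_pos : S `<=` [set n : int | 0 < n])
    (S_infinite : infinite_set S)
    (s_enum : range s = S)
    (s_incr : increasing_seq s)
    (s_gaps : limn_einf (fun i : nat => ((s i.+1 - s i)%:~R : R)%:E) = +oo%E) :
  (ord R S <= 2%:E)%E.
Proof.
apply: ge_ereal_sup => _ [m [_ mS] <-]; rewrite lee_fin ler_nat leqNgt.
apply/negP => m3; apply: (not_walkable3 S_pos _ (walkable_le m3 mS)).
exact: sparse_of_gaps s_enum s_incr s_gaps.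
Qed.
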